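(* Let $(G,+,0,d)$ be a strictly convex metric group. For all $x\in G$, the metric subgroup $\mathbb{R}x=\{tx:t\in\mathbb{R}\}\subseteq G$ is isomorphic, as a topological group, to the additive group $\mathbb{R}$ of real numbers.
   Context: A metric space $(X,d)$ is strictly convex if for any $x,y\in X$ and any positive reals $a,b$ with $a+b=d(x,y)$, the intersection $B[x,a]\cap B[y,b]$ is a singleton, where $B[x,a]=\{z\in X:d(x,z)\le a\}$. A metric group is a (not necessarily commutative, additively written) group $(G,+,0)$ with a metric $d$ satisfying $d(x+c,y+c)=d(x,y)=d(c+x,c+y)$ for all $x,y,c\in G$; put $\|x\|=d(0,x)$. It is strictly convex if the metric space $(G,d)$ is. In a strictly convex metric space, for all points $x,y$ there is a unique isometry $\gamma:[0,d(x,y)]\to X$ with $\gamma(0)=x$, $\gamma(d(x,y))=y$ (known). Metric multiplication: for $x\in G$ and $t\in[0,1]$, $t*x=\gamma(t\|x\|)$, where $\gamma:[0,\|x\|]\to G$ is the unique isometry with $\gamma(0)=0$ and $\gamma(\|x\|)=x$. Algebraic multiplication: for $n\in\mathbb{Z}$ and $x\in G$, $n\cdot x$ is the usual integer multiple ($0\cdot x=0$, $(n+1)\cdot x=n\cdot x+x$, $-(n+1)\cdot x=-n\cdot x-x$ for $n\ge 0$). Real multiplication: for $t\in\mathbb{R}$ and $x\in G$, $tx=[t]\cdot x+\{t\}*x$, where $[t]$ is the integer part (floor) of $t$ and $\{t\}=t-[t]\in[0,1)$. The subgroup $\mathbb{R}x$ carries the topology induced by the metric $d$, and $\mathbb{R}$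 its usual topology. A topological group isomorphism is a continuous group homomorphism whose inverse is also a continuous group homomorphism.
   Formalization: The isomorphism of ℝx with ℝ is asserted only for x ≠ 0, since for x = 0 the subgroup ℝ0 = {0} is trivial and not isomorphic to ℝ; that ℝx is a subgroup is still proved for all x. *)

(* Defs.v *)
(* Groups are the (not necessarily commutative) groupType of
   MathComp, whose law is written multiplicatively: x + y, 0, - x and n . x in
   additive notation are x * y, 1, x^-1 and x ^+ n here. *)
From HB Require Import structures.
From mathcomp Require Import all_boot all_order all_algebra.
From mathcomp Require Import all_classical all_reals all_analysis.

Set Implicit Arguments.
Unset Strict Implicit.
Unset Printing Implicit Defensive.

Import Order.TTheory GRing.Theory Num.Theory.
Import numFieldNormedType.Exports.

Local Open Scope classical_set_scope.
Local Open Scope ring_scope.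

HB.mixin Record Metric_isBiinvariant (R : numDomainType) G
    & Metric R G & Group G := {
  mdist_mulgr : forall c x y : G, mdist (x * c)%g (y * c)%g = mdist x y :> R;
  mdist_mulgl : forall c x y : G, mdist (c * x)%g (c * y)%g = mdist x y :> R
}.

#[short(type="metricGroupType")]
HB.structure Definition MetricGroup (R : numDomainType) :=
  { G of Metric R G & Group G & Metric_isBiinvariant R G }.

(* Not the library's closed_ball, which is the closure of the open ball. *)
Definition mcball (R : realType) (T : metricType R) (x : T) (a : R) : set T :=
  [set z | mdist x z <= a].

Definition strictly_convex (R : realType) (T : metricType R) : Prop :=
  forall (x y : T) (a b : R), 0 < a -> 0 < b -> a + b = mdist x y ->
    exists z, mcball x a `&` mcball y b = [set z].

(* An isometry [0, d(x, y)] -> T from x to y is represented by a function on all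
   of R, whose values outside of the interval are irrelevant. *)
Definition geodesic (R : realType) (T : metricType R) (x y : T) (g : R -> T) :
    Prop :=
  [/\ {in `[0, mdist x y] &, forall s t, mdist (g s) (g t) = `|s - t|},
      g 0 = x & g (mdist x y) = y].

Section multiplications.
Context {R : realType} {G : metricGroupType R}.
Implicit Types (x : G) (t : R) (n : int).

Definition mnorm x : R := mdist (1%g : G) x.

(* In a strictly convex metric space a geodesic exists and its restriction to
   [0, ||x||] is unique, so the choice made by xget is immaterial for t in
   [0, 1]; other values of t are never used. *)
Definition metric_mul t x : G :=
  xget (fun=> 1%g) [set g | geodesic 1%g x g] (t * mnorm x).

Definition alg_mul n x : G :=
  match n with Posz k => (x ^+ k)%g | Negz k => (x ^- k.+1)%g end.

Lemma alg_mul0 x : alg_mul 0 x = 1%g.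
Proof. by []. Qed.

Lemma alg_mulS (k : nat) x : alg_mul k.+1%:Z x = (alg_mul k%:Z x * x)%g.
Proof. exact: expgSr. Qed.

Lemma alg_mulNS (k : nat) x :
  alg_mul (- k.+1%:Z) x = (alg_mul (- k%:Z) x * x^-1)%g.
Proof.
rewrite -NegzE; case: k => [|k]; first by rewrite oppr0/= mul1g.
by rewrite -NegzE/= expgS invgM.
Qed.

Definition real_mul t x : G :=
  (alg_mul (Num.floor t) x * metric_mul (t - (Num.floor t)%:~R) x)%g.

Definition real_line x : set G := range (real_mul^~ x).

(* The additive topological group R and the subgroup A, with the topology
   induced by the metric of G, are isomorphic. Only the restriction of g to A
   matters; as f lands in A, its continuity into G is continuity into A. *)
Definition topgroup_iso_real (A : set G) : Prop :=
  exists (f : R -> G) (g : G -> R),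
    [/\ (forall t, A (f t)) /\ cancel f g /\ {in A, cancel g f},
        forall s t, f (s + t) = (f s * f t)%g,
        {in A &, forall y z, g (y * z)%g = g y + g z},
        continuous f
      & {within A, continuous g}].

End multiplications.

(* Main.v *)
(* For a point x of norm L, strict convexity provides a unique geodesic from 0
   to x, and metric_mul^~ x follows it at speed L. By translation invariance
   and uniqueness of metrically intermediate points, metric_mul^~ x is additive
   as long as the parameters sum up to at most 1, so real_mul^~ x is a
   homomorphism R -> G.
   It multiplies distances by L. Indeed, if m is the midpoint of 0 and y, then
   m + m = y. If y + y = 0, then - m is also a midpoint of 0 and y = - y, so
   m = - m and y = m + m = 0: there is no 2-torsion. As u commutes with u + u,
   conjugation by u fixes the midpoint m of 0 and u + u, so m commutes with u,
   (m - u) + (m - u) = 0, m = u and ||u + u|| = 2 ||u||. Thus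
   ||t x|| = 2^n ||(t / 2^n) x|| = |t| L. *)
Require Import Defs.
From HB Require Import structures.
From mathcomp Require Import all_boot all_order all_algebra.
From mathcomp Require Import all_classical all_reals all_analysis.
From mathcomp Require Import lra.
Import numFieldNormedType.Exports.
Import Order.TTheory GRing.Theory Num.Theory.
Local Open Scope classical_set_scope.
Local Open Scope ring_scope.

(** * Intermediate points and geodesics *)

Section StrictlyConvexSpace.
Context {R : realType} {T : metricType R} (hT : strictly_convex T).
Implicit Types (x y z : T) (a b : R).

(** For positive radii both points lie in a one-point intersection of balls; a zero radius forces
    both to be the same endpoint. *)
Lemma between_uniq x y z w a b : 0 <= a -> 0 <= b -> a + b = mdist x y ->
  mdist x z <= a -> mdist z y <= b -> mdist x w <= a -> mdist w y <= b -> z = w.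
Proof.
have mdist_le0 u v : mdist u v <= 0 -> u = v.
  by move=> uv; apply: mdist_positivity; apply/le_anti; rewrite uv mdist_ge0.
rewrite !le_eqVlt => /predU1P[<- _ _|a0].
  by rewrite -!le_eqVlt => /mdist_le0 <- _ /mdist_le0 <-.
move=> /predU1P[<- _|b0 abE]; rewrite -!le_eqVlt.
  by move=> _ /mdist_le0 -> _ /mdist_le0 ->.
have [c /seteqP[sub _]] := hT x y a b a0 b0 abE.
move=> xz zy xw wy; transitivity c; last symmetry; apply: sub; split => //=;
  by rewrite /mcball /= metric_sym.
Qed.

Lemma between_ex x y a b : 0 <= a -> 0 <= b -> a + b = mdist x y ->
  exists z, mdist x z <= a /\ mdist z y <= b.
Proof.
rewrite !le_eqVlt => /predU1P[<- _|a0].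
  by rewrite add0r => ->; exists x; rewrite mdistxx.
move=> /predU1P[<-|b0 abE].
  by rewrite addr0 => ->; exists y; rewrite mdistxx.
have [c /seteqP[_ /(_ c erefl)[xc yc]]] := hT x y a b a0 b0 abE.
by exists c; split => //; rewrite metric_sym.
Qed.

(** Uniqueness of intermediate points makes the separately chosen [g s] fit together into an
    isometry. *)
Lemma geodesic_ex x y : exists g, geodesic x y g.
Proof.
set L := mdist x y.
have /choice[g gP] : forall s, exists z, 0 <= s <= L ->
    mdist x z <= s /\ mdist z y <= L - s.
  move=> s; have [/andP[s0 sL]|_] := boolP (0 <= s <= L); last by exists x.
  have [||z zP] := @between_ex x y s (L - s) s0; rewrite ?subr_ge0 //.
    by rewrite addrC subrK.
  by exists z.
have L0 : 0 <= L := mdist_ge0 _ _.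
have gE s z : 0 <= s <= L -> mdist x z <= s -> mdist z y <= L - s -> z = g s.
  move=> sL xz zy; have [xg gy] := gP s sL; have [s0 sL'] := andP sL.
  by apply: (@between_uniq x y z (g s) s (L - s));
    rewrite ?subr_ge0 ?[s + _]addrC ?subrK.
have dist s t : 0 <= s -> s <= t -> t <= L -> mdist (g s) (g t) = t - s.
  move=> s0 st tL; have t0 := le_trans s0 st; have sL := le_trans st tL.
  have [xt ty] : mdist x (g t) <= t /\ mdist (g t) y <= L - t.
    by apply: gP; rewrite t0.
  have tri := metric_triangle x (g t) y; rewrite -/L in tri.
  have xtE : mdist x (g t) = t by apply/le_anti; rewrite xt /=; lra.
  (* [w] lies between [x] and [g t], hence also between [x] and [y], so uniqueness gives
     [w = g s]. *)
  have [||w [xw wt]] := @between_ex x (g t) s (t - s) s0.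
  - by rewrite subr_ge0.
  - by rewrite xtE addrC subrK.
  have tri' := metric_triangle w (g t) y.
  have <- : w = g s by apply: gE => //; [rewrite s0|lra].
  have tri'' := metric_triangle x w (g t).
  by apply/le_anti; rewrite wt /=; lra.
exists g; split => [s t|  |].
- rewrite !in_itv /= => /andP[s0 sL] /andP[t0 tL].
  have [st|/ltW ts] := leP s t.
    by rewrite dist // distrC ger0_norm ?subr_ge0.
  by rewrite metric_sym dist // ger0_norm ?subr_ge0.
- by apply/esym/gE; rewrite ?lexx ?mdistxx ?subr0.
- by apply/esym/gE; rewrite ?lexx ?L0 ?mdistxx ?subrr.
Qed.

End StrictlyConvexSpace.

(** * Bi-invariant metric and integer multiples *)

Section MetricGroup.
Context {R : realType} {G : metricGroupType R}.
Implicit Types (x y u v : G) (n : int) (t : R).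

Lemma mdistV x y : mdist x^-1%g y^-1%g = mdist x y :> R.
Proof.
by rewrite -(mdist_mulgl x) -(mdist_mulgr y) mulgV mul1g mulgVK metric_sym.
Qed.

Lemma mdist1V x : mdist 1%g x^-1%g = mdist 1%g x :> R.
Proof. by rewrite -{1}invg1 mdistV. Qed.

Lemma mdistE x y : mdist x y = mnorm (x^-1 * y)%g.
Proof. by rewrite /mnorm -[RHS](mdist_mulgl x) mulg1 mulVKg. Qed.

Lemma mnorm_gt0 x : x <> 1%g -> 0 < mnorm x.
Proof. by move=> x1; rewrite mdist_gt0; apply/eqP => /esym. Qed.

Lemma alg_mulDr1 n x : alg_mul (n + 1) x = (alg_mul n x * x)%g.
Proof.
case: n => k; first by rewrite -PoszD addn1 alg_mulS.
rewrite NegzE alg_mulNS mulgVK; congr alg_mul.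
by rewrite intS opprD addrAC addNr add0r.
Qed.

Lemma alg_mulD n m x : alg_mul (n + m) x = (alg_mul n x * alg_mul m x)%g.
Proof.
elim: m => [|k IH|k IH]; first by rewrite addr0 mulg1.
  by rewrite -addn1 PoszD addrA !alg_mulDr1 IH mulgA.
apply: (mulIg x); rewrite -mulgA -!alg_mulDr1 -addrA.
have -> : - k.+1%:Z + 1 = - k%:Z by rewrite intS opprD addrAC addNr add0r.
exact: IH.
Qed.

Lemma commute_alg_mul n x y : commute y x -> commute y (alg_mul n x).
Proof. by case: n => k xy; [|apply: commuteV]; apply: commuteX. Qed.

(** * Metric multiplication along geodesics *)

Hypothesis hG : strictly_convex G.

Lemma metric_mul_geodesic x : exists2 g, geodesic 1%g x g &
  forall t, metric_mul t x = g (t * mnorm x).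
Proof.
by exists (xget (fun=> 1%g) [set g | geodesic 1%g x g]) => //;
  apply/(@xgetPex _ _ [set g | geodesic 1%g x g])/geodesic_ex.
Qed.

Lemma metric_mul0 x : metric_mul 0 x = 1%g.
Proof. by have [g [_ g0 _] ->] := metric_mul_geodesic x; rewrite mul0r. Qed.

Lemma metric_mul1 x : metric_mul 1 x = x.
Proof. by have [g [_ _ g1] ->] := metric_mul_geodesic x; rewrite mul1r. Qed.

Lemma mdist_metric_mul s t x : 0 <= s <= 1 -> 0 <= t <= 1 ->
  mdist (metric_mul s x) (metric_mul t x) = `|s - t| * mnorm x.
Proof.
move=> /andP[s0 s1] /andP[t0 t1].
have [g [dist _ _] gE] := metric_mul_geodesic x.
have L0 : 0 <= mnorm x := mdist_ge0 _ _.
rewrite !gE dist -?mulrBl ?normrM ?(ger0_norm L0) // in_itv /= mulr_ge0 //=.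
  by rewrite ler_piMl.
by rewrite ler_piMl.
Qed.

Lemma mnorm_metric_mul t x : 0 <= t <= 1 ->
  mnorm (metric_mul t x) = t * mnorm x.
Proof.
move=> t01; have /andP[t0 _] := t01.
by rewrite {1}/mnorm -{1}(metric_mul0 x) mdist_metric_mul ?lexx ?ler01 //
  sub0r normrN ger0_norm.
Qed.

Lemma metric_mulD s t x : 0 <= s -> 0 <= t -> s + t <= 1 ->
  metric_mul (s + t) x = (metric_mul s x * metric_mul t x)%g.
Proof.
move=> s0 t0 st1; set ms := metric_mul s x; set mt := metric_mul t x.
set mst := metric_mul (s + t) x; set L := mnorm x.
have L0 : 0 <= L := mdist_ge0 _ _.
have s01 : 0 <= s <= 1 by lra.
have t01 : 0 <= t <= 1 by lra.
have st01 : 0 <= s + t <= 1 by lra.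
(* By left and right invariance, both sides lie at distance [t * L] from the identity and [s * L]
   from [mst]. *)
suff : (ms^-1 * mst = mt)%g by move=> <-; rewrite mulVKg.
apply: (@between_uniq _ _ hG 1%g mst _ _ (t * L) (s * L)).
- exact: mulr_ge0.
- exact: mulr_ge0.
- by rewrite -mulrDl addrC [RHS]mnorm_metric_mul.
- rewrite -[leLHS]/(mnorm _) -mdistE mdist_metric_mul //.
  by rewrite opprD addrA subrr sub0r normrN ger0_norm.
- by rewrite -{2}(mul1g mst) mdist_mulgr metric_sym mdist1V
    [leLHS]mnorm_metric_mul.
- by rewrite [leLHS]mnorm_metric_mul.
- by rewrite mdist_metric_mul // opprD addrCA subrr addr0 normrN ger0_norm.
Qed.

(** [x] is the product of its [t] and [1 - t] parts in either order. *)
Lemma commute_metric_mul t x : 0 <= t <= 1 -> commute (metric_mul t x) x.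
Proof.
move=> t01.
have E : x = (metric_mul t x * metric_mul (1 - t) x)%g.
  by rewrite -metric_mulD ?[t + _]addrC ?subrK ?metric_mul1 //; lra.
have E' : x = (metric_mul (1 - t) x * metric_mul t x)%g.
  by rewrite -metric_mulD ?subrK ?metric_mul1 //; lra.
by apply: (etrans (congr1 (fun z => metric_mul t x * z)%g E'));
  rewrite mulgA -E.
Qed.

(** * Additivity of real multiplication *)

Lemma real_mulE n t x : 0 <= t <= 1 ->
  real_mul (n%:~R + t) x = (alg_mul n x * metric_mul t x)%g.
Proof.
(* At [t = 1] the floor jumps to [n + 1] and the fractional part is 0. *)
move=> /andP[t0]; rewrite le_eqVlt => /predU1P[->|t1]; rewrite /real_mul.
  rewrite metric_mul1 -alg_mulDr1 -[n%:~R + 1]intrD1 (intrKfloor (n + 1)).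
  by rewrite subrr metric_mul0 mulg1.
have -> : Num.floor (n%:~R + t) = n.
  by apply: floor_def; rewrite intrD1 lerDl t0 ltrD2l.
by rewrite addrC addKr.
Qed.

Lemma real_mulP t : exists n s, [/\ 0 <= s, s < 1 & t = n%:~R + s].
Proof.
exists (Num.floor t), (t - (Num.floor t)%:~R).
have := floor_itv t; rewrite intrD1 => /andP[? ?].
by split; lra.
Qed.

(** Integer and fractional parts commute, so they add separately; a fractional sum above 1 carries
    one factor [x]. *)
Lemma real_mulD s t x : real_mul (s + t) x = (real_mul s x * real_mul t x)%g.
Proof.
have [n [a [a0 a1 ->]]] := real_mulP s; have [m [b [b0 b1 ->]]] := real_mulP t.
rewrite !real_mulE ?a0 ?b0 ?ltW // mulgA -(mulgA (alg_mul n x)).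
rewrite (@commute_alg_mul m x); last first.
  by apply: commute_metric_mul; rewrite a0 ltW.
rewrite mulgA -alg_mulD -mulgA addrACA -intrD.
have [ab|ab] := leP (a + b) 1.
  by rewrite real_mulE ?addr_ge0 // metric_mulD.
have -> : (n + m)%:~R + (a + b) = (n + m + 1)%:~R + (a + b - 1) :> R.
  by rewrite intrD1; lra.
rewrite real_mulE ?alg_mulDr1; last by lra.
(* The piece [1 - a] completes [a] to 1, which supplies the carried [x]. *)
have -> : metric_mul b x = (metric_mul (1 - a) x * metric_mul (a + b - 1) x)%g.
  by rewrite -metric_mulD; [congr metric_mul|..]; lra.
rewrite (mulgA (metric_mul a x)) -metric_mulD ?(addrC a) ?subrK ?metric_mul1 ?mulgA //;
  lra.
Qed.

Lemma real_mul0 x : real_mul 0 x = 1%g.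
Proof. by apply: (mulgI (real_mul 0 x)); rewrite -real_mulD addr0 mulg1. Qed.

Lemma real_mulN t x : real_mul (- t) x = (real_mul t x)^-1%g.
Proof.
by apply: (mulgI (real_mul t x)); rewrite -real_mulD subrr real_mul0 mulgV.
Qed.

(** * Midpoints and doubling of the norm *)

Lemma midpoint_sqr y : exists u, [/\ (u * u)%g = y, mnorm u = mnorm y / 2 &
  forall v, mdist 1%g v <= mnorm y / 2 -> mdist v y <= mnorm y / 2 -> v = u].
Proof.
have L0 : 0 <= mnorm y := mdist_ge0 _ _.
have h01 : 0 <= (2^-1 : R) <= 1 by apply/andP; split; lra.
have n2 : mnorm (metric_mul 2^-1 y) = mnorm y / 2.
  by rewrite mnorm_metric_mul // mulrC.
(* Additivity makes this a square root of [y]; strict convexity makes it the only midpoint. *)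
exists (metric_mul 2^-1 y); split=> [||v yv vy] //.
  have hh : 2^-1 + 2^-1 = 1 :> R by lra.
  by have /andP[h0 _] := h01; rewrite -metric_mulD ?hh ?metric_mul1.
apply: (between_uniq hG _ _ _ _ _ _ _ _ _ yv vy).
- by lra.
- by lra.
- by rewrite -/(mnorm y); lra.
- by rewrite -[leLHS]/(mnorm _) n2.
- rewrite -{2}(metric_mul1 y) mdist_metric_mul //; last by rewrite lexx ler01.
  by rewrite -/(mnorm y) ler0_norm; lra.
Qed.

Lemma sqrg_eq1 y : (y * y)%g = 1%g -> y = 1%g.
Proof.
move=> yy; have [u [uu un uq]] := midpoint_sqr y.
have yV : y^-1%g = y by apply: (mulgI y); rewrite mulgV yy.
have un' : mdist 1%g u <= mnorm y / 2 by rewrite -un.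
have uy : mdist u y <= mnorm y / 2.
  by rewrite -{1}uu -{1}(mulg1 u) mdist_mulgl.
(* As [y^-1 = y], inversion preserves distances to the identity and to [y], so it fixes their
   midpoint. *)
have uV : u^-1%g = u by apply: uq; rewrite ?mdist1V // -{1}yV mdistV.
by rewrite -uu -{1}uV mulVg.
Qed.

Lemma mnorm_sqr y : mnorm (y * y)%g = mnorm y *+ 2.
Proof.
have [u [uu un uq]] := midpoint_sqr (y * y)%g.
have ny : mdist (1 : G)%g u <= mnorm (y * y)%g / 2 by rewrite -un.
have uy : mdist u (y * y)%g <= mnorm (y * y)%g / 2.
  by rewrite -{1}uu -{1}(mulg1 u) mdist_mulgl.
(* Conjugation by [y] is an isometry fixing the identity and [y * y]. *)
have yuy : (y * u * y^-1)%g = u.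
  apply: uq.
    by rewrite -(mdist_mulgr y) mulgVK mul1g -{1}(mulg1 y) mdist_mulgl.
  by rewrite -(mdist_mulgr y) mulgVK -mulgA mdist_mulgl.
have yu : (y * u = u * y)%g by rewrite -{2}yuy mulgVK.
suff uE : u = y by rewrite mulr2n -uE uu un -splitr.
(* Since [u] and [y] commute and have the same square, [u * y^-1] squares to the identity. *)
apply/(mulIg y^-1%g); rewrite mulgV; apply: sqrg_eq1.
have uVy : commute y^-1%g u by apply/commute_sym/commuteV/commute_sym.
by rewrite mulgA -(mulgA u) uVy mulgA uu mulgK mulgV.
Qed.

(** Repeated halving brings [t] into [[-1, 1]], where the geodesic gives the norm; doubling the norm
    undoes each halving. *)
Lemma mnorm_real_mul t x : mnorm (real_mul t x) = `|t| * mnorm x.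
Proof.
have base s : 0 <= s <= 1 -> mnorm (real_mul s x) = s * mnorm x.
  by move=> s01; rewrite -(add0r s) (@real_mulE 0) //
    mul1g mnorm_metric_mul ?add0r.
have lt2n : `|t| <= 2 ^+ Num.bound `|t| by apply/ltW/upper_nthrootP.
move: (Num.bound _) lt2n => n; elim: n t => [|n IH] t.
  rewrite expr0; have [t0 t1|t0 t1] := leP 0 t.
    by rewrite base ?t0 ?ger0_norm // -(ger0_norm t0).
  rewrite -{1}(opprK t) real_mulN /mnorm mdist1V [LHS]base ?ltr0_norm //.
  by rewrite oppr_ge0 ltW //= -ltr0_norm.
rewrite exprS => tn; rewrite {1}(_ : t = t / 2 + t / 2); last by lra.
have t2 : `|t / 2| = `|t| / 2.
  by rewrite normrM (ger0_norm (_ : 0 <= 2^-1)) //; lra.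
rewrite real_mulD mnorm_sqr IH t2; first by lra.
by lra.
Qed.

Lemma mdist_real_mul s t x :
  mdist (real_mul s x) (real_mul t x) = `|s - t| * mnorm x.
Proof. by rewrite mdistE -real_mulN -real_mulD mnorm_real_mul addrC distrC. Qed.

End MetricGroup.

(** * The isomorphism with the reals and its continuity *)

Theorem corollary36 (R : realType) (G : metricGroupType R)
    (hG : strictly_convex G) (x : G) :
  group_closed (mem (real_line x)) /\
  (x <> 1%g -> topgroup_iso_real (real_line x)).
Proof.
split.
  split; first by apply/mem_set; exists 0 => //; exact: real_mul0.
  move=> _ _ /set_mem[s _ <-] /set_mem[t _ <-]; apply/mem_set.
  by exists (s - t) => //; rewrite real_mulD // real_mulN.
move=> /mnorm_gt0 L0.
have inj : injective (real_mul^~ x).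
  move=> s t st; have := mdist_real_mul hG s t x.
  rewrite st mdistxx => /esym/eqP.
  by rewrite mulf_eq0 (gt_eqF L0) orbF normr_eq0 subr_eq0 => /eqP.
(* The default 0 is taken only off the line. *)
pose g y := xget 0 [set t | real_mul t x = y].
have fg y : real_line x y -> real_mul (g y) x = y.
  move=> [t _ ty].
  by apply: (@xgetPex _ 0 [set t | real_mul t x = y]); exists t.
exists (real_mul^~ x), g; split.
- split; first by move=> t; exists t.
  by split=> [t|y /set_mem/fg//]; apply/inj/fg; exists t.
- by move=> s t; exact: real_mulD.
- move=> y z /set_mem/fg yE /set_mem/fg zE; apply: inj.
  rewrite real_mulD // yE zE; apply: fg.
  by exists (g y + g z) => //; rewrite real_mulD // yE zE.
(* Distances scale by exactly [mnorm x]: radius [e / mnorm x] works here, and [e * mnorm x] for the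
   inverse. *)
- move=> t; apply/metricType_numDomainType.cvgrPdist_lt => e e0.
  near=> s; rewrite mdist_real_mul // -ltr_pdivlMr //.
  near: s; apply: cvgr_dist_lt; [exact: cvg_id|exact: divr_gt0].
- apply/subspace_continuousP => y /fg yE; apply/cvgrPdist_lt => e e0.
  rewrite near_withinE; near=> z => /fg zE.
  rewrite -(ltr_pM2r L0) -mdist_real_mul // yE zE.
  near: z; apply: metricType_numDomainType.cvgr_dist_lt;
    [exact: cvg_id|exact: mulr_gt0].
Unshelve. all: by end_near. Qed.
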